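(* Let $\Gamma$ be a rooted tree with vertex set $\{x_1,\ldots,x_n\}$, directed away from its root, and let $t\ge 2$ be an integer. Then the graded Betti numbers $\beta_{i,j}(I_t(\Gamma))$ of the path ideal $I_t(\Gamma)\subseteq R=k[x_1,\ldots,x_n]$ are independent of the characteristic of the field $k$ (that is, for all $i,j$ the number $\beta_{i,j}(I_t(\Gamma))$ is the same for every choice of the field $k$).
   Context: A tree is a finite simple graph in which any two distinct vertices are joined by a unique path. A tree $\Gamma$ is viewed as a directed graph by choosing any vertex to be the root and directing every edge away from the root. The vertices of $\Gamma$ are identified with the variables of $R=k[x_1,\ldots,x_n]$. A path of length $t$ in a directed graph is a sequence of $t$ vertices $x_{i_1},\ldots,x_{i_t}$ such that $(x_{i_j},x_{i_{j+1}})$ is a directed edge for $j=1,\ldots,t-1$ (length counts vertices). The path ideal $I_t(\Gamma)\subseteq R$ is generated by the monomials $x_{i_1}\cdots x_{i_t}$ over all paths $x_{i_1},\ldots,x_{i_t}$ of length $t$ in $\Gamma$. For a finitely generated graded $R$-module $M$ with minimal graded free resolution $0\to\bigoplus_jR(-j)^{\beta_{p,j}(M)}\to\cdots\to\bigoplus_jR(-j)^{\beta_{0,j}(M)}\to M\to0$, the numbers $\beta_{i,j}(M)$ are its graded Betti numbers. *)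

(* Defs.v *)
From mathcomp Require Import all_boot all_order all_algebra.
From mathcomp Require Import mpoly.

Set Implicit Arguments.
Unset Strict Implicit.
Unset Printing Implicit Defensive.

Import GRing.Theory.
Local Open Scope ring_scope.

Section RootedTrees.

Variable T : finType.
Implicit Types (e : rel T) (r u v : T).

(* The vertices of the path are u :: p. *)
Definition simple_path e u v (p : seq T) : bool :=
  [&& path e u p, last u p == v & uniq (u :: p)].

Definition is_tree e : Prop :=
  [/\ ssrbool.symmetric e, irreflexive e
    & forall u v, u != v -> exists! p, simple_path e u v p].

(* u -> v is a directed edge when the path from the root r to v reaches v by
   the edge {u, v}; by rcons p v, the edge relation e u v is implied. *)
Definition dedge e r u v : Prop :=
  exists2 p, simple_path e r v (rcons p v) & last r p = u.

(* The length t counts vertices, not edges. *)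
Definition dpath e r (t : nat) (p : t.-tuple T) : Prop :=
  forall i j : 'I_t, j = i.+1 :> nat -> dedge e r (tnth p i) (tnth p j).

End RootedTrees.

Section Ideals.

Variables (k : fieldType) (n : nat).
Local Notation R := {mpoly k[n]}.

Definition ideal_gen (S : R -> Prop) : R -> Prop := fun f =>
  exists2 s : seq (R * R),
    (forall q, q \in s -> S q.2) & f = \sum_(q <- s) q.1 * q.2.

Definition path_ideal (e : rel 'I_n) (r : 'I_n) (t : nat) : R -> Prop :=
  ideal_gen (fun f =>
    exists2 p : t.-tuple 'I_n, dpath e r p & f = \prod_(x <- p) 'X_x).

(* The data of a sequence of graded free modules and maps
     ... -> F_1 -> F_0 -> R,   F_i = \bigoplus_(a < rk i) R(- sh a).
   Elements of F_i are row vectors and matrices act on the right. *)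
Record free_seq : Type := FreeSeq {
  rk : nat -> nat;
  sh : forall i, 'I_(rk i) -> int;
  bd : forall i, 'M[R]_(rk i.+1, rk i);
  aug : 'cV[R]_(rk 0)
}.

(* All maps are homogeneous of degree 0; as stated, a zero entry satisfies
   the condition for any shifts. *)
Definition graded (F : free_seq) : Prop :=
  (forall i a b (m : 'X_{1..n}), m \in msupp (bd F i a b) ->
     (mdeg m)%:Z + sh b = sh a) /\
  (forall a b (m : 'X_{1..n}), m \in msupp (aug F a b) ->
     (mdeg m)%:Z = sh a).

(* F is exact with image I in R, and F_i = 0 for i large; injectivity of the
   leftmost nonzero map is part of exactness. *)
Definition resolves (F : free_seq) (I : R -> Prop) : Prop :=
  [/\ exists l, forall i, (l < i)%N -> rk F i = 0%N,
      forall f, I f <-> exists v, v *m aug F = f%:M,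
      forall v : 'rV_(rk F 0), v *m aug F = 0 <-> exists w, v = w *m bd F 0
    & forall i (v : 'rV_(rk F i.+1)),
        v *m bd F i = 0 <-> exists w, v = w *m bd F i.+1].

(* The image of F_(i+1) lies in (x_1, ..., x_n) F_i. *)
Definition minimal (F : free_seq) : Prop :=
  forall i a b, (bd F i a b)@_0%MM = 0.

Definition min_graded_free_resolution (F : free_seq) (I : R -> Prop) : Prop :=
  [/\ graded F, resolves F I & minimal F].

(* b is the graded Betti number beta_(i,j)(I) of the module I: the number of
   summands R(-j) in homological degree i of the minimal graded free
   resolution of I (of I itself, not of R / I). *)
Definition is_graded_betti (I : R -> Prop) (i : nat) (j : int) (b : nat) :
    Prop :=
  (exists F, min_graded_free_resolution F I) /\
  (forall F, min_graded_free_resolution F I ->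
     #|[set a : 'I_(rk F i) | sh a == j]| = b).

End Ideals.

Arguments path_ideal k {n} e r t.

(* Main.v *)
Require Import Defs.
From mathcomp Require Import all_boot all_order all_algebra.
From mathcomp Require Import mpoly.
From Stdlib Require Import IndefiniteDescription.

(* Order the vertices by: u is below v when u lies on the path from the root to
   v.  Directed paths are convex chains of this forest order.  Let a family of
   convex chains generate a squarefree monomial ideal I, let z be a leaf, and
   let F be the smallest chain containing z.  All chains containing z are nested,
   so I = J + (x_F), where J is generated by the chains avoiding z.  The colon
   ideal (J : x_F) is generated by the sets A \ F with A in J, which are convex
   chains of the forest with F removed, so induction applies to both J and
   (J : x_F).  The mapping cone of multiplication by x_F resolves I, and it is
   minimal because the chain map can be chosen divisible by the variable z.  The
   ranks and shifts obtained in this way do not involve the field.  By the usual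
   homotopy argument every minimal graded resolution has the same ranks and
   shifts. *)

Set Implicit Arguments.
Unset Strict Implicit.
Unset Printing Implicit Defensive.

Import GRing.Theory.
Local Open Scope ring_scope.

(** * Graded lifts and uniqueness of graded Betti numbers *)

(** Chain maps are built one degree at a time, in types that depend on the degree; this turns the
    stagewise existence into one family. *)
Lemma dependent_choice_nat (T : nat -> Type) (P : forall i, T i -> Prop)
    (Q : forall i, T i -> T i.+1 -> Prop) (x0 : T 0) :
  P 0 x0 ->
  (forall i x, P i x -> exists2 y, P i.+1 y & Q i x y) ->
  exists f : forall i, T i,
    [/\ f 0 = x0, forall i, P i (f i) & forall i, Q i (f i) (f i.+1)].
Proof.
move=> P0 step.
have step' i (x : {x | P i x}) :
    {y : {y | P i.+1 y} | Q i (sval x) (sval y)}.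
  apply: constructive_indefinite_description; case: x => x Px /=.
  by have [y Py Qxy] := step i x Px; exists (exist _ y Py).
pose f := fix f i : {x | P i x} :=
  if i is i'.+1 then sval (step' i' (f i')) else exist _ x0 P0.
exists (fun i => sval (f i)); split=> // i; first exact: svalP.
exact: (svalP (step' i (f i))).
Qed.

Section Homogeneous.

Variables (n : nat) (k : comNzRingType).
Local Notation R := {mpoly k[n]}.
Implicit Types (d : int) (p q : R).

Definition homog_at d p := forall m, m \in msupp p -> (mdeg m)%:Z = d.

Lemma homog_at0 d : homog_at d 0.
Proof. by move=> m; rewrite msupp0. Qed.

Lemma homog_atX m : homog_at (mdeg m)%:Z 'X_[m].
Proof. by move=> m'; rewrite msuppX inE => /eqP ->. Qed.

Lemma homog_at1 : homog_at 0 1.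
Proof. by move=> m; rewrite msupp1 inE => /eqP ->; rewrite mdeg0. Qed.

Lemma homog_atM d d' p q :
  homog_at d p -> homog_at d' q -> homog_at (d + d') (p * q).
Proof.
move=> hp hq m /msuppM_le /allpairsP[[m1 m2] /= [/hp <- /hq <- ->]].
by rewrite mdegD PoszD.
Qed.

Lemma homog_at_sum d (I : finType) (F : I -> R) :
  (forall i, homog_at d (F i)) -> homog_at d (\sum_i F i).
Proof.
move=> hF; elim/big_rec: _ => [|i p _ hp]; first exact: homog_at0.
by move=> m /msuppD_le; rewrite mem_cat => /orP[/hF|/hp].
Qed.

Definition hpart d p : R :=
  \sum_(m <- msupp p | (mdeg m)%:Z == d) p@_m *: 'X_[m].

Lemma mcoeff_hpart d p m :
  (hpart d p)@_m = if (mdeg m)%:Z == d then p@_m else 0.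
Proof.
rewrite /hpart big_mkcond raddf_sum /=.
have -> : p@_m = \sum_(m' <- msupp p) p@_m' * (m' == m)%:R.
  rewrite {1}[p]mpolyE raddf_sum /=.
  by apply: eq_bigr => m' _; rewrite mcoeffZ mcoeffX.
transitivity (\sum_(m' <- msupp p)
    if (mdeg m)%:Z == d then p@_m' * (m' == m)%:R else 0).
  apply: eq_bigr => m' _; have [<-|ne_m] := eqVneq m' m.
    by case: ifP; rewrite ?mcoeff0 // mcoeffZ mcoeffX eqxx.
  rewrite mulr0; case: ifP => _; rewrite ?mcoeffZ ?mcoeffX ?(negPf ne_m).
    by rewrite mulr0 if_same.
  by rewrite mcoeff0 if_same.
by case: ifP => // _; rewrite big1.
Qed.

Lemma hpart_homog d p : homog_at d (hpart d p).
Proof.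
move=> m; rewrite mcoeff_msupp mcoeff_hpart.
by case: ifP => [/eqP|]; rewrite ?eqxx.
Qed.

Lemma hpart_id d p : homog_at d p -> hpart d p = p.
Proof.
move=> hp; apply/mpolyP => m; rewrite mcoeff_hpart; case: eqP => // ne_d.
by rewrite memN_msupp_eq0 //; apply/negP => /hp.
Qed.

Lemma hpart_sum d (I : finType) (F : I -> R) :
  hpart d (\sum_i F i) = \sum_i hpart d (F i).
Proof.
apply/mpolyP => m; rewrite mcoeff_hpart [RHS]raddf_sum.
rewrite [X in if _ then X else _]raddf_sum /=.
case: ifPn => deg_m; last first.
  by rewrite big1 // => i _; rewrite mcoeff_hpart (negPf deg_m).
by apply: eq_bigr => i _; rewrite mcoeff_hpart deg_m.
Qed.

(** Write [p] as its component of degree [d] plus a rest: the rest times [q] has no monomial of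
    degree [d + d']. *)
Lemma hpartM d d' p q :
  homog_at d' q -> hpart (d + d') (p * q) = hpart d p * q.
Proof.
move=> hq; have e_p : p = hpart d p + (p - hpart d p) by rewrite addrC subrK.
rewrite -[RHS](hpart_id (homog_atM (@hpart_homog d p) hq)).
apply/mpolyP => m; rewrite !mcoeff_hpart; case: eqP => // deg_m.
rewrite {1}e_p mulrDl mcoeffD.
suff -> : ((p - hpart d p) * q)@_m = 0 by rewrite addr0.
apply: memN_msupp_eq0; apply/negP.
move=> /msuppM_le /allpairsP[[m1 m2] /= [m1p /hq deg_m2 e_m]].
move: deg_m; rewrite e_m mdegD PoszD deg_m2 => /addIr deg_m1.
by move: m1p; rewrite mcoeff_msupp mcoeffB mcoeff_hpart deg_m1 eqxx subrr eqxx.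
Qed.

(** The matrix of a degree 0 map between graded free modules with generators in degrees [s] and
    [s']; a negative difference forces a zero entry. *)
Definition hmx (p q : nat) (s : 'I_p -> int) (s' : 'I_q -> int)
    (M : 'M[R]_(p, q)) :=
  forall a b, homog_at (s a - s' b) (M a b).

Lemma hmxM (p q r : nat) (s : 'I_p -> int) (s' : 'I_q -> int)
    (s'' : 'I_r -> int) M N :
  hmx s s' M -> hmx s' s'' N -> hmx s s'' (M *m N).
Proof.
move=> hM hN a c; rewrite mxE; apply: homog_at_sum => b.
by rewrite -[s a](subrK (s' b)) -addrA; apply: homog_atM.
Qed.

(** The given row solutions need not be homogeneous; keeping only the component of the required
    degree in each coefficient still solves the equation. *)
Lemma hmx_lift (p q r : nat) (s : 'I_p -> int) (s' : 'I_q -> int)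
    (s'' : 'I_r -> int) (D : 'M_(p, q)) (V : 'M_(r, q)) :
  hmx s s' D -> hmx s'' s' V -> (forall c, exists w, row c V = w *m D) ->
  exists2 W : 'M_(r, p), hmx s'' s W & W *m D = V.
Proof.
move=> hD hV /fin_all_exists[w e_w].
exists (\matrix_(c, a) hpart (s'' c - s a) (w c 0 a)).
  by move=> c a; rewrite mxE; apply: hpart_homog.
apply/matrixP => c b; rewrite mxE -[RHS](hpart_id (hV c b)).
have -> : V c b = \sum_a w c 0 a * D a b.
  by have /rowP/(_ b) := e_w c; rewrite !mxE.
rewrite hpart_sum; apply: eq_bigr => a _; rewrite mxE -(hpartM _ _ (hD a b)).
by rewrite addrA subrK.
Qed.

End Homogeneous.

(** Augmented complex: [R] sits in position 0 with its generator in degree 0, and [F_i] in position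
    [i.+1], so the augmentation becomes an ordinary differential. *)
Definition ark (r : nat -> nat) i := if i is i'.+1 then r i' else 1%N.

Definition ash r (s : forall i, 'I_(r i) -> int) i : 'I_(ark r i) -> int :=
  if i is i'.+1 then s i' else fun=> 0.

(** * Comparison maps between graded free resolutions *)

Section Resolutions.

Variables (n : nat) (k : fieldType).
Local Notation R := {mpoly k[n]}.
Implicit Types (F G : free_seq k n) (I J : R -> Prop).

Definition gsh F i : 'I_(ark (rk F) i) -> int := ash (@sh _ _ F) (i:=i).

Definition abd F i : 'M[R]_(ark (rk F) i.+1, ark (rk F) i) :=
  if i is i'.+1 then bd F i' else aug F.

Lemma hmx_abd F i : graded F -> hmx (@gsh F i.+1) (@gsh F i) (abd F i).
Proof.
case: i => [|i] [hbd haug] a b m.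
  by move=> /haug /= ->; rewrite subr0.
by move=> /hbd /= <-; rewrite addrK.
Qed.

Lemma abd_exact F I i (v : 'rV_(ark (rk F) i.+1)) : resolves F I ->
  v *m abd F i = 0 <-> exists w, v = w *m abd F i.+1.
Proof. by case=> _ _ ex0 exS; case: i v => [|i] v; [apply: ex0|apply: exS]. Qed.

Lemma abd_abd F I i : resolves F I -> abd F i.+1 *m abd F i = 0.
Proof.
move=> resF; apply/row_matrixP => a; rewrite row_mul row0.
by apply/(abd_exact _ resF); exists (delta_mx 0 a); rewrite -rowE.
Qed.

Lemma aug_in F I a : resolves F I -> I (aug F a 0).
Proof.
case=> _ -> _ _; exists (delta_mx 0 a); rewrite -rowE.
by apply/rowP => b; rewrite !mxE ord1 mulr1n.
Qed.

(** Comparison theorem for multiplication by [g]: exactness of [G] fills the squares one by one,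
    with degrees raised by [d]. *)
Lemma chain_lift F G I J (g : R) d :
  graded F -> resolves F I -> graded G -> resolves G J ->
  homog_at d g -> (forall f, I f -> J (f * g)) ->
  exists phi : forall i, 'M[R]_(ark (rk F) i, ark (rk G) i),
    [/\ phi 0%N = g%:M,
        forall i, hmx (fun a => gsh a + d) (@gsh G i) (phi i)
      & forall i, phi i.+1 *m abd G i = abd F i *m phi i].
Proof.
move=> gF rF gG rG hg IJ.
(* The second clause is the invariant that lets the next square be filled: the composite lands in
   the image of the differential of [G]. *)
pose P i (phi : 'M[R]_(ark (rk F) i, ark (rk G) i)) :=
  hmx (fun a => gsh a + d) (@gsh G i) phi
  /\ forall a, exists w, row a (abd F i *m phi) = w *m abd G i.
pose Q i (phi : 'M[R]_(ark (rk F) i, ark (rk G) i))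
  (psi : 'M[R]_(ark (rk F) i.+1, ark (rk G) i.+1)) :=
  psi *m abd G i = abd F i *m phi.
have P0 : P 0%N (g%:M).
  split=> [a b|a].
    by rewrite !ord1 mxE eqxx /= subr0 add0r.
  have [_ resJ _ _] := rG.
  have /resJ[w e_w] := IJ _ (aug_in a rF).
  exists w; rewrite /= e_w mul_mx_scalar; apply/rowP => b.
  by rewrite !mxE ord1 eqxx mulr1n mulrC.
have [|phi [phi0 Pphi Qphi]] := @dependent_choice_nat _ P Q _ P0.
  move=> i phi [hphi imphi].
  have hF : hmx (fun a => gsh a + d) (fun a => gsh a + d)
      (abd F i).
    by move=> a b; rewrite opprD addrACA subrr addr0; apply: hmx_abd.
  have [psi hpsi e_psi] := hmx_lift (@hmx_abd G i gG) (hmxM hF hphi) imphi.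
  exists psi => //; split=> // a; apply/(abd_exact _ rG).
  by rewrite -row_mul -mulmxA e_psi mulmxA (abd_abd _ rF) mul0mx row0.
by exists phi; split=> // i; have [] := Pphi i.
Qed.

Definition cst p q (M : 'M[R]_(p, q)) : 'M[k]_(p, q) := map_mx (mcoeff 0%MM) M.

Lemma cst0 p q : @cst p q 0 = 0. Proof. exact: raddf0. Qed.

Lemma cstM p q r (M : 'M_(p, q)) (N : 'M_(q, r)) :
  cst (M *m N) = cst M *m cst N.
Proof. exact: map_mxM. Qed.

Lemma cst_minimal F i : minimal F -> cst (abd F i.+1) = 0.
Proof. by move=> minF; apply/matrixP => a b; rewrite !mxE; apply: minF. Qed.

(* A chain endomorphism lifting the identity of I is homotopic to the identity,
   and the homotopy terms vanish modulo the variables by minimality. *)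
Lemma cst_endo F I (chi : forall i, 'M[R]_(ark (rk F) i)) :
  resolves F I -> minimal F -> chi 0%N = 1%:M ->
  (forall i, chi i.+1 *m abd F i = abd F i *m chi i) ->
  forall i, cst (chi i.+1) = 1%:M.
Proof.
move=> rF minF chi0 chiS.
have step i (h : 'M[R]_(ark (rk F) i, ark (rk F) i.+1)) :
    abd F i *m (1%:M - chi i - h *m abd F i) = 0 ->
    exists h', 1%:M - chi i.+1 - abd F i *m h = h' *m abd F i.+1.
  move=> e_h.
  have im a : exists w,
      row a (1%:M - chi i.+1 - abd F i *m h) = w *m abd F i.+1.
    apply/(abd_exact _ rF); rewrite -row_mul !mulmxBl mul1mx chiS -mulmxA.
    by rewrite -[X in X - _ - _]mulmx1 -!mulmxBr e_h row0.
  have [w e_w] := fin_all_exists im.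
  exists (\matrix_a w a); apply/row_matrixP => a.
  by rewrite e_w row_mul rowK.
have homot i : exists2 h : 'M[R]_(ark (rk F) i, ark (rk F) i.+1),
    cst (abd F i *m h) = 0 & abd F i *m (1%:M - chi i - h *m abd F i) = 0.
  elim: i => [|i [h _ /step[h' e_h']]].
    (* In position 0 the homotopy is zero, which settles the constant terms there: minimality does
       not constrain [aug F]. *)
    by exists 0; rewrite ?mulmx0 ?cst0 // chi0 subrr mul0mx subr0 mulmx0.
  exists h'; first by rewrite cstM cst_minimal // mul0mx.
  rewrite -e_h' opprB addrCA subrr addr0 mulmxA.
  by rewrite (abd_abd _ rF) mul0mx.
move=> i; have [h cst_h /step[h' e_h']] := homot i.
have : cst (1%:M - chi i.+1) = 0.
  rewrite -[_ - chi _](subrK (abd F i *m h)) e_h' /cst map_mxD -!/(cst _).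
  by rewrite cst_h addr0 cstM cst_minimal // mulmx0.
by rewrite /cst map_mxB map_mx1 => /eqP; rewrite subr_eq0 => /eqP <-.
Qed.

End Resolutions.

(** Rows of [A] of degree [j] vanish outside the columns of degree [j], so the blocks of degree [j]
    still multiply to the identity, which bounds the sizes. *)
Lemma leq_card_degree (k : fieldType) (D : eqType) p q (s : 'I_p -> D)
    (s' : 'I_q -> D) (A : 'M[k]_(p, q)) (B : 'M_(q, p)) j :
  A *m B = 1%:M -> (forall a b, A a b != 0 -> s a = s' b) ->
  (#|[set a | s a == j]| <= #|[set b | s' b == j]|)%N.
Proof.
move=> AB1 hA; set S := [set a | _]; set T := [set b | _].
pose A' := \matrix_(i < #|S|, l < #|T|) A (enum_val i) (enum_val l).
pose B' := \matrix_(l < #|T|, i < #|S|) B (enum_val l) (enum_val i).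
suff /mulmx1_min : A' *m B' = 1%:M by [].
apply/matrixP => i i'; rewrite !mxE.
have /matrixP/(_ (enum_val i) (enum_val i')) := AB1; rewrite !mxE.
rewrite (inj_eq enum_val_inj) => <-.
rewrite [RHS](bigID (mem T)) /= [X in _ = _ + X]big1 ?addr0.
  rewrite [RHS]big_enum_val /=.
  by apply: eq_bigr => l _; rewrite !mxE.
move=> b; rewrite inE => s'b; suff -> : A (enum_val i) b = 0 by rewrite mul0r.
apply/eqP; apply: contraNT s'b => /hA <-.
by have := enum_valP i; rewrite inE.
Qed.

Section Uniqueness.

Variables (n : nat) (k : fieldType).
Implicit Types (F G : free_seq k n).

(** Lifts of the identity from [F] to [G] and back compose to the identity modulo the variables, and
    their constant entries join only generators of equal degree. *)
Lemma leq_betti F G I i j :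
  min_graded_free_resolution F I -> min_graded_free_resolution G I ->
  (#|[set a : 'I_(rk F i) | sh a == j]|
     <= #|[set a : 'I_(rk G i) | sh a == j]|)%N.
Proof.
move=> [gF rF mF] [gG rG mG].
have h1 : homog_at 0 (1 : {mpoly k[n]}) by exact: homog_at1.
have II f : I f -> I (f * 1) by rewrite mulr1.
have [phi [phi0 hphi phiS]] := chain_lift gF rF gG rG h1 II.
have [psi [psi0 _ psiS]] := chain_lift gG rG gF rF h1 II.
have e_chi := @cst_endo _ _ F I (fun i => phi i *m psi i) rF mF.
apply: (@leq_card_degree k _ _ _ _ _ (cst (phi i.+1)) (cst (psi i.+1))).
  rewrite -cstM; apply: e_chi => [|l].
    by rewrite phi0 psi0 mul1mx.
  by rewrite -mulmxA psiS mulmxA phiS mulmxA.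
move=> a b; rewrite mxE -mcoeff_msupp => /(hphi i.+1) /=.
by rewrite mdeg0 addr0 => /esym/eqP; rewrite subr_eq0 => /eqP.
Qed.

Lemma eq_betti F G I i j :
  min_graded_free_resolution F I -> min_graded_free_resolution G I ->
  #|[set a : 'I_(rk F i) | sh a == j]| = #|[set a : 'I_(rk G i) | sh a == j]|.
Proof. by move=> mF mG; apply/eqP; rewrite eqn_leq !(@leq_betti _ _ I). Qed.

End Uniqueness.

(** * Mapping cones *)

(** Position [i] of the cone is [F_i] plus a shifted [G_(i-1)], with [G_(-1)] equal to [R]; the
    latter carries the generator added to the ideal. *)
Definition cone_rk (r r' : nat -> nat) i := (r i + ark r' i)%N.

Definition cone_sh r r' (s : forall i, 'I_(r i) -> int)
    (s' : forall i, 'I_(r' i) -> int) (d : int) i (a : 'I_(cone_rk r r' i)) :=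
  match split a with inl b => s i b | inr b => ash s' b + d end.

Section Cone.

Variables (n : nat) (k : fieldType).
Local Notation R := {mpoly k[n]}.

(** Lift [v'] to [w], correct [v] by [w *m phi1] to get a cycle for [D], and lift this to [u]; the
    sign in the last block dictates the witness [row_mx u (- w)]. *)
Lemma cone_ker p p1 q p' p1' (D : 'M[R]_(p, q)) (D1 : 'M[R]_(p1, p))
    (D1' : 'M[R]_(p1', p')) (phi : 'M[R]_(p', q)) (phi1 : 'M[R]_(p1', p))
    (v : 'rV_p) (v' : 'rV_p') :
  (forall w : 'rV_p, w *m D = 0 -> exists u, w = u *m D1) ->
  phi1 *m D = D1' *m phi -> v *m D + v' *m phi = 0 ->
  (exists w, v' = w *m D1') ->
  exists w, row_mx v v' = w *m block_mx D1 0 phi1 (- D1').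
Proof.
move=> exD comm e_v [w e_v'].
have [u e_u] : exists u, v + w *m phi1 = u *m D1.
  by apply: exD; rewrite mulmxDl -mulmxA comm mulmxA -e_v'.
exists (row_mx u (- w)).
by rewrite mul_row_block mulmx0 add0r !mulNmx mulmxN opprK -e_v' -e_u addrK.
Qed.

(* As C M is inside J, the chain map of the cone can be taken to be 'X_z times a
   lift of multiplication by M; this keeps the cone minimal. *)
Lemma cone_resolution (F G : free_seq k n) (I J C : R -> Prop) (z : 'I_n)
    (M : R) d :
  min_graded_free_resolution F J -> min_graded_free_resolution G C ->
  homog_at d M ->
  (forall f, I f <-> exists g, J (f - g * ('X_z * M))) ->
  (forall f, C f <-> J (f * ('X_z * M))) -> (forall f, C f -> J (f * M)) ->
  (forall f, C f -> f@_0%MM = 0) ->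
  exists bd aug, min_graded_free_resolution
    (@FreeSeq k n (cone_rk (rk F) (rk G))
       (cone_sh (@sh _ _ F) (@sh _ _ G) (d + 1)) bd aug) I.
Proof.
move=> [gF rF mF] [gG rG mG] hM I_JM C_JM CJ C0.
have [psi [psi0 hpsi psiS]] := chain_lift gG rG gF rF hM CJ.
pose phi i := ('X_z : R) *: psi i.
have hphi i : hmx (fun a => gsh a + (d + 1)) (@gsh _ _ F i) (phi i).
  move=> a b; rewrite mxE addrA [_ + 1 - _]addrAC addrC.
  apply: (homog_atM _ (hpsi i a b)).
  by have := @homog_atX n k U_(z)%MM; rewrite mdeg1.
have phiS i : phi i.+1 *m abd F i = abd G i *m phi i.
  by rewrite -scalemxAl psiS scalemxAr.
have phi0 : phi 0%N = ('X_z * M)%:M by rewrite /phi psi0 scale_scalar_mx.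
exists (fun i => block_mx (bd F i) 0 (phi i.+1) (- abd G i)).
exists (col_mx (aug F) (phi 0%N)).
split; first split; rewrite /cone_sh /=.
- move=> i a b; case: (split_ordP a) => a' ->; case: (split_ordP b) => b' -> m.
  + by rewrite block_mxEul; apply: (proj1 gF).
  + by rewrite block_mxEur mxE msupp0.
  + rewrite block_mxEdl => /(hphi i.+1) ->.
    by rewrite subrK.
  + rewrite block_mxEdr mxE (perm_mem (msuppN _)) => /(hmx_abd gG) ->.
    by rewrite addrA subrK.
- move=> a b; case: (split_ordP a) => a' -> m.
  + by rewrite col_mxEu; apply: (proj2 gF).
  + by rewrite col_mxEd => /(hphi 0%N) ->; rewrite subr0.
- have [[lF lF0] imF _ _] := rF; have [[lG lG0] _ _ _] := rG.
  split=> /=.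
  (* [G] enters the cone one position later, hence the successor. *)
  + exists (maxn lF lG.+1) => i; rewrite gtn_max /cone_rk => /andP[lFi].
    by case: i lFi => // i lFi lGi; rewrite lF0 //= lG0.
  + move=> f; rewrite I_JM; split=> [[g /imF[v e_v]]|[v]].
      exists (row_mx v g%:M); rewrite mul_row_col e_v phi0 -scalar_mxM.
      by rewrite -raddfD /= subrK.
    rewrite -[v]hsubmxK mul_row_col phi0 => e_f; exists (rsubmx v 0 0).
    apply/imF; exists (lsubmx v); rewrite raddfB /= -e_f.
      rewrite [(rsubmx v 0 0 * _)%:M]scalar_mxM.
    by rewrite -mx11_scalar addrK.
  + move=> v; split=> [|[w ->]].
      rewrite -[v]hsubmxK mul_row_col => e_v.
      apply: (cone_ker _ (phiS 0%N) e_v) => [w|].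
        by case: (@abd_exact _ _ F J 0 w rF).
      (* In position 0 the second component of a kernel element lies in the colon ideal [C], the
         image of [aug G]. *)
      have [_ imG _ _] := rG.
      have /imG[w e_w] : C (rsubmx v 0 0).
        apply/C_JM; apply/imF; exists (- lsubmx v).
        rewrite mulNmx [(rsubmx v 0 0 * _)%:M]scalar_mxM -mx11_scalar -phi0.
        by apply/eqP; rewrite eq_sym -subr_eq0 opprK addrC e_v.
      by exists w; rewrite e_w -mx11_scalar.
    rewrite -mulmxA mul_block_col mul0mx addr0 (phiS 0%N) mulNmx subrr.
    by rewrite (abd_abd 0 rF) col_mx0 mulmx0.
  + move=> i v; split=> [|[w ->]].
      rewrite -[v]hsubmxK mul_row_block mulmx0 add0r mulmxN => e_v.
      have [e_v1 /eqP] : lsubmx v *m bd F i + rsubmx v *m phi i.+1 = 0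
          /\ - (rsubmx v *m abd G i) = 0.
        by apply: eq_row_mx; rewrite row_mx0.
      rewrite oppr_eq0 => /eqP/(abd_exact _ rG) e_v2.
      apply: (cone_ker _ (phiS i.+1) e_v1 e_v2) => w.
      by case: (@abd_exact _ _ F J i.+1 w rF).
    rewrite -mulmxA mulmx_block !mul0mx !mulmx0 !addr0 !add0r.
    rewrite !mulNmx mulmxN opprK.
    rewrite (phiS i.+1) subrr (abd_abd i.+1 rF) (abd_abd i rG).
    by rewrite block_mx0 mulmx0.
- move=> i a b /=; case: (split_ordP a) => a' ->; case: (split_ordP b) => b' ->.
  + by rewrite block_mxEul; apply: mF.
  + by rewrite block_mxEur mxE mcoeff0.
  + by rewrite block_mxEdl mxE rmorphM /= mcoeffX mnm1_eq0 mul0r.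
  (* For [i = 0] this block is [- aug G], whose constant terms vanish because its entries lie in
     [C]. *)
  + rewrite block_mxEdr mxE mcoeffN; apply/eqP; rewrite oppr_eq0; apply/eqP.
    case: i a a' b b' => [|i] a a' b b'; last exact: mG.
    by rewrite ord1; apply/C0/(aug_in _ rG).
Qed.

End Cone.

(** * Resolutions with ranks and shifts uniform in the field *)

Section Resolvable.

Variable n : nat.
Implicit Types (I J C : forall k : fieldType, {mpoly k[n]} -> Prop).

(** Ranks and shifts come before the field, while the maps may depend on it; this order of
    quantifiers carries the independence of the characteristic. *)
Definition resolvable I := exists r (s : forall i, 'I_(r i) -> int),
  forall k, exists bd aug,
    min_graded_free_resolution (@FreeSeq k n r s bd aug) (I k).

Lemma resolvable_ext I J :
  (forall k f, I k f <-> J k f) -> resolvable J -> resolvable I.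
Proof.
move=> IJ [r [s resJ]]; exists r, s => k.
have [bd [aug [gJ [lJ imJ ex0 exS] mJ]]] := resJ k.
by exists bd, aug; split=> //; split=> // f; rewrite IJ.
Qed.

Lemma resolvable_zero : resolvable (fun k f => f = 0).
Proof.
exists (fun=> 0%N), (fun _ _ => 0) => k.
exists (fun=> 0), 0; split=> //; first by split=> [i|] [].
  split=> [|f|v|i v]; first by exists 0%N.
  - split=> [->|[v]]; first by exists 0; rewrite mulmx0 raddf0.
    by rewrite /= mulmx0 => /esym/matrixP/(_ 0 0); rewrite !mxE mulr1n.
  - by split=> _; [exists 0; apply/rowP => -[]|apply: mulmx0].
  - by split=> _; [exists 0; apply/rowP => -[]|apply: mulmx0].
by move=> i [].
Qed.

Lemma resolvable_unit : resolvable (fun k f => True).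
Proof.
exists (fun i => (i == 0)%N : nat), (fun _ _ => 0) => k.
exists (fun=> 0), 1%:M; split.
- split=> [i []//|a b m].
  by rewrite /= !ord1 mxE msupp1 inE => /eqP ->; rewrite mdeg0.
- split=> [|f|v|i v] /=.
  + by exists 0%N => -[].
  + by split=> // _; exists f%:M; rewrite mulmx1.
  + rewrite mulmx1; split=> [->|[w ->]]; first by exists 0; rewrite mul0mx.
    by rewrite mulmx0.
  + by split=> _; [exists 0; apply/rowP => -[]|apply: mulmx0].
- by move=> i [].
Qed.

Lemma resolvable_cone I J C (z : 'I_n) (m : 'X_{1..n}) :
  resolvable J -> resolvable C ->
  (forall k f, I k f <-> exists g, J k (f - g * 'X_[U_(z) + m])) ->
  (forall k f, C k f <-> J k (f * 'X_[U_(z) + m])) ->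
  (forall k f, C k f -> J k (f * 'X_[m])) ->
  (forall k f, C k f -> f@_0%MM = 0) ->
  resolvable I.
Proof.
move=> [r [s resJ]] [r' [s' resC]] I_J C_J CJ C0.
exists (cone_rk r r'), (cone_sh s s' ((mdeg m)%:Z + 1)) => k.
have [bdJ [augJ mJ]] := resJ k; have [bdC [augC mC]] := resC k.
apply: (cone_resolution mJ mC (@homog_atX n k m)) (CJ k) (C0 k) => f;
  by rewrite -mpolyXD.
Qed.

End Resolvable.

(** * Ideals of convex chains in a forest *)

Section ForestChains.

Variables (T : finType) (le : rel T) (h : T -> nat).
Implicit Types A B F V : {set T}.
Hypothesis le_total_below : forall a b c, le a c -> le b c -> le a b || le b a.
Hypothesis le_height : forall a b, le a b -> a = b \/ (h a < h b)%N.

(** Convexity is relative to [V], so that it survives removing the same vertices from [V] and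
    [A]. *)
Definition convex_chain V A :=
  [/\ A \subset V, {in A &, forall a b, le a b || le b a}
    & forall a b c, a \in A -> c \in A -> b \in V ->
        le a b -> le b c -> b \in A].

Lemma convex_chainD V A F :
  convex_chain V A -> convex_chain (V :\: F) (A :\: F).
Proof.
move=> [AV chA cvA]; split; first exact: setSD.
  by move=> a b /setDP[aA _] /setDP[bA _]; apply: chA.
move=> a b c /setDP[aA _] /setDP[cA _] /setDP[bV bF] ab bc.
by rewrite inE bF; apply: (cvA a b c).
Qed.

(** By maximality of [z], both chains lie below [z], where elements are comparable. If [a] in [A] is
    not in [B], each [b] in [B] lies above [a], hence in [A] by convexity, and [B] would be smaller
    than [A]. *)
Lemma convex_chain_leaf V A B z :
  convex_chain V A -> convex_chain V B -> z \in A -> z \in B ->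
  {in V, forall x, (h x <= h z)%N} -> (#|A| <= #|B|)%N -> A \subset B.
Proof.
move=> [AV chA cvA] [BV chB cvB] zA zB maxz leAB.
apply: contraLR leAB => nAB; rewrite -ltnNge.
have below (D : {set T}) a : D \subset V ->
    {in D &, forall a b, le a b || le b a} -> z \in D -> a \in D -> le a z.
  move=> DV chD zD aD; have /orP[//|le_za] := chD _ _ aD zD.
  have [e_z|] := le_height le_za; first by move: le_za; rewrite e_z.
  by rewrite ltnNge maxz // (subsetP DV).
apply: proper_card; rewrite properE nAB andbT; apply/subsetP => b bB.
have /subsetPn[a aA aB] := nAB.
have le_az := below A a AV chA zA aA; have le_bz := below B b BV chB zB bB.
have /orP[ab|ba] := le_total_below le_az le_bz.
  by apply: (cvA a b z) => //; apply: (subsetP BV).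
by case/negP: aB; apply: (cvB b a z) => //; apply: (subsetP AV).
Qed.

End ForestChains.

(** * Squarefree monomial ideals and the induction on the vertex set *)

Section SquarefreeIdeals.

Variable n : nat.
Implicit Types (A F : {set 'I_n}) (FF : {set {set 'I_n}}) (m : 'X_{1..n}).

Definition mvars m : {set 'I_n} := [set x | m x != 0%N].

Definition mono A : 'X_{1..n} := [multinom (x \in A : nat) | x < n].

Lemma mvarsD m m' : mvars (m + m')%MM = mvars m :|: mvars m'.
Proof. by apply/setP => x; rewrite !inE mnmDE addn_eq0 negb_and. Qed.

Lemma mvars_mono A : mvars (mono A) = A.
Proof. by apply/setP => x; rewrite !inE mnmE; case: (x \in A). Qed.

Lemma mono_le A m : (mono A <= m)%MM = (A \subset mvars m).
Proof.
apply/mnm_lepP/subsetP => [le_m x xA|le_m x].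
  by have := le_m x; rewrite mnmE xA inE lt0n.
by rewrite mnmE; case: (boolP (x \in A)) => // /le_m; rewrite inE lt0n.
Qed.

Lemma monoD1 z A : z \in A -> mono A = (U_(z) + mono (A :\ z))%MM.
Proof.
move=> zA; apply/mnmP => x; rewrite !mnmE !inE eq_sym.
by case: eqVneq => [->|]; rewrite ?zA.
Qed.

(* The ideal generated by the squarefree monomials prod_(x in A) 'X_x for A in
   FF: a polynomial belongs to it when all its monomials do. *)
Definition sqf_ideal FF (k : fieldType) (f : {mpoly k[n]}) :=
  forall m, m \in msupp f -> exists2 A, A \in FF & A \subset mvars m.

Section Field.

Variable k : fieldType.
Implicit Types (f g : {mpoly k[n]}).

Lemma sqf_ideal0 FF : sqf_ideal FF (0 : {mpoly k[n]}).
Proof. by move=> m; rewrite msupp0. Qed.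

Lemma sqf_idealD FF f g :
  sqf_ideal FF f -> sqf_ideal FF g -> sqf_ideal FF (f + g).
Proof. by move=> hf hg m /msuppD_le; rewrite mem_cat => /orP[/hf|/hg]. Qed.

Lemma sqf_ideal_sum FF (I : eqType) (r : seq I) (P : pred I)
    (F : I -> {mpoly k[n]}) :
  (forall i, i \in r -> P i -> sqf_ideal FF (F i)) ->
  sqf_ideal FF (\sum_(i <- r | P i) F i).
Proof.
move=> hF; rewrite big_seq_cond; elim/big_ind: _ => //.
- exact: sqf_ideal0.
- exact: sqf_idealD.
- by move=> i /andP[]; apply: hF.
Qed.

Lemma sqf_ideal_mul FF f g : sqf_ideal FF g -> sqf_ideal FF (f * g).
Proof.
move=> hg m /msuppM_le /allpairsP[[m1 m2] /= [_ /hg[A AFF Am2] ->]].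
by exists A => //; rewrite mvarsD (subset_trans Am2) ?subsetUr.
Qed.

Lemma sqf_idealX FF A m : A \in FF -> A \subset mvars m ->
  sqf_ideal FF ('X_[m] : {mpoly k[n]}).
Proof. by move=> AFF Am m'; rewrite msuppX inE => /eqP ->; exists A. Qed.

Lemma sqf_idealMX FF f m :
  sqf_ideal FF (f * 'X_[m]) <->
  forall m', m' \in msupp f ->
    exists2 A, A \in FF & A \subset mvars m :|: mvars m'.
Proof.
split=> [hf m' m'f|hf m'].
  rewrite -mvarsD; apply: hf; rewrite (perm_mem (msuppMX _ _)).
  exact: map_f.
by rewrite (perm_mem (msuppMX _ _)) => /mapP[m'' /hf ? ->]; rewrite mvarsD.
Qed.

(** Let [g] be the quotient of the part of [f] divisible by the monomial of [F]. Each remaining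
    monomial is divisible by a generator not containing [F], which therefore avoids [z]. *)
Lemma sqf_ideal_split FF F z f :
  F \in FF -> (forall A, A \in FF -> z \in A -> F \subset A) ->
  sqf_ideal FF f <->
  exists g, sqf_ideal [set A in FF | z \notin A] (f - g * 'X_[mono F]).
Proof.
move=> FFF minF; split=> [hf|[g hg]]; last first.
  rewrite -[f](subrK (g * 'X_[mono F])); apply: sqf_idealD.
    by move=> m /hg[A]; rewrite inE => /andP[AFF _]; exists A.
  by apply/sqf_ideal_mul/(sqf_idealX FFF); rewrite mvars_mono.
pose div m := F \subset mvars m.
exists (\sum_(m <- msupp f | div m) f@_m *: 'X_[m - mono F]).
rewrite {1}[f]mpolyE (bigID div) /= mulr_suml.
rewrite [X in X + _ - _](eq_bigr
  (fun m => f@_m *: 'X_[m - mono F] * 'X_[mono F])); last first.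
  by move=> m divm; rewrite -scalerAl -mpolyXD submK // mono_le.
rewrite addrAC subrr add0r; apply: sqf_ideal_sum => m /hf[A AFF Am] ndivm.
rewrite -mul_mpolyC; apply/sqf_ideal_mul/(sqf_idealX _ Am).
rewrite inE AFF; apply: contraNN ndivm => zA.
exact: subset_trans (minF A AFF zA) Am.
Qed.

End Field.

(** Dividing the monomial of [A] by its gcd with that of [F] leaves [A :\: F], so these sets
    generate the colon ideal. *)
Definition colon FF F : {set {set 'I_n}} := [set A :\: F | A in FF].

Lemma resolvable_split FF F z :
  F \in FF -> z \in F -> (forall A, A \in FF -> z \in A -> F \subset A) ->
  (forall A, A \in FF -> z \notin A -> ~~ (A \subset F)) ->
  resolvable (sqf_ideal [set A in FF | z \notin A]) ->
  resolvable (sqf_ideal (colon [set A in FF | z \notin A] F)) ->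
  resolvable (sqf_ideal FF).
Proof.
move=> FFF zF minF subF resJ resC.
apply: (resolvable_cone (z := z) (m := mono (F :\ z)) resJ resC) => k f;
  rewrite -?(monoD1 zF).
- exact: sqf_ideal_split.
- rewrite sqf_idealMX mvars_mono.
  split=> hf m /hf[A].
    by case/imsetP=> A' A'J ->; rewrite subDset; exists A'.
  by move=> AJ; rewrite -subDset; exists (A :\: F) => //; apply: imset_f.
(* The generator [A] does not contain [z], so multiplying by the monomial of [F :\ z] already
   suffices. *)
- move=> hf; apply/sqf_idealMX => m /hf[_ /imsetP[A AJ ->]].
  rewrite mvars_mono => /subsetP Am; exists A => //; apply/subsetP => x xA.
  rewrite !inE; have [xF|xF] := boolP (x \in F).
    rewrite andbT; have [e_x|//] := eqVneq x z.
    by move: AJ; rewrite inE -e_x xA andbF.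
  by have := Am x; rewrite !inE xF xA andbF => /(_ isT) ->.
- move=> hf; apply/eqP; rewrite mcoeff_eq0; apply/negP => /hf[B].
  case/imsetP => A; rewrite inE => /andP[AFF zA] {B}->.
  have -> : mvars 0%MM = set0 by apply/setP => x; rewrite !inE mnm0E.
  by rewrite subset0 setD_eq0; apply/negP/subF.
Qed.

Lemma resolvable_convex_chains (le : rel 'I_n) (h : 'I_n -> nat) V FF :
  (forall a b c, le a c -> le b c -> le a b || le b a) ->
  (forall a b, le a b -> a = b \/ (h a < h b)%N) ->
  (forall A, A \in FF -> convex_chain le V A) -> resolvable (sqf_ideal FF).
Proof.
move=> le_total_below le_height.
have [N] := ubnP #|V|; elim: N => // N IHN in V FF *; rewrite ltnS => leVN chFF.
(* Over an empty [V] only the empty set can be a generator: the ideal is zero or the whole ring. *)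
have [V0|[z0 z0V]] := set_0Vmem V.
  have subF A : A \in FF -> A = set0.
    by case/chFF; rewrite V0 subset0 => /eqP.
  have [FF0|[A AFF]] := set_0Vmem FF.
    apply: resolvable_ext (resolvable_zero n) => k f; split=> [hf|->].
      apply/eqP; rewrite -msupp_eq0; case e_f: (msupp f) => [//|m s].
      by have := hf m; rewrite e_f mem_head => -[] // A; rewrite FF0 inE.
    exact: sqf_ideal0.
  apply: resolvable_ext (resolvable_unit n) => k f; split=> // _ m _.
  by exists A; rewrite // (subF A AFF) sub0set.
have [z zV maxz] : exists2 z, z \in V & {in V, forall x, (h x <= h z)%N}.
  by case: (arg_maxnP h z0V) => z zV maxz; exists z.
pose JJ := [set A in FF | z \notin A].
have ltD F : z \in F -> (#|V :\: F| < N)%N.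
  move=> zF; apply: leq_trans leVN; apply: proper_card.
  rewrite properE subsetDl /=; apply/subsetPn; exists z => //.
  by rewrite inE zF.
have resJ : resolvable (sqf_ideal JJ).
  apply: (IHN (V :\ z)); first by apply: ltD; rewrite inE.
  move=> A; rewrite inE => /andP[AFF zA].
  have -> : A = A :\ z by rewrite (setDidPl _) // disjoint_sym disjoints1.
  exact/convex_chainD/chFF.
have [FFz0|[F0]] := set_0Vmem [set A in FF | z \in A].
  suff <- : JJ = FF by [].
  apply/setP => A; have /setP/(_ A) := FFz0; rewrite !inE.
  by case: (A \in FF) => //= ->.
rewrite inE => F0FFz.
case: (@arg_minnP _ F0 (fun A => (A \in FF) && (z \in A)) (fun A => #|A|))
  => // F /andP[FFF zF] minF.
have subF A : A \in FF -> z \in A -> F \subset A.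
  move=> AFF zA; apply: (convex_chain_leaf le_total_below le_height _ _ zF zA maxz).
  - exact: chFF.
  - exact: chFF.
  - by apply: minF; rewrite AFF.
(* If a generator avoiding [z] lies in [F], those through [z] are redundant and [JJ] gives the same
   ideal; otherwise the colon ideal is proper. *)
have [/existsP[A /and3P[AFF zA AF]]|noA] :=
    boolP [exists A, [&& A \in FF, z \notin A & A \subset F]].
  apply: resolvable_ext resJ => k f; split=> hf m /hf[B].
    move=> BFF Bm; have [zB|zB] := boolP (z \in B); last first.
      by exists B; rewrite // inE BFF.
    exists A; first by rewrite inE AFF.
    exact: subset_trans AF (subset_trans (subF B BFF zB) Bm).
  by rewrite inE => /andP[BFF _]; exists B.
apply: (resolvable_split FFF zF subF) => //.
  move=> A AFF zA; apply: contraNN noA => AF.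
  by apply/existsP; exists A; apply/and3P.
apply: (IHN (V :\: F)); first exact: ltD.
move=> B /imsetP[A]; rewrite inE => /andP[AFF _] ->.
exact/convex_chainD/chFF.
Qed.

End SquarefreeIdeals.

(** * Path ideals *)

Section PathIdeals.

Variable n : nat.

Lemma mono_seq (k : fieldType) (s : seq 'I_n) : uniq s ->
  \prod_(x <- s) 'X_x = 'X_[mono [set x in s]] :> {mpoly k[n]}.
Proof.
elim: s => [_|x s IHs /andP[xs uniq_s]].
  rewrite big_nil -mpolyX0; congr 'X_[_]; apply/mnmP => y.
  by rewrite mnm0E mnmE inE.
rewrite big_cons IHs // -mpolyXD; congr 'X_[_]; apply/mnmP => y.
rewrite !mnmE !inE eq_sym.
by have [->|//] := eqVneq y x; rewrite (negPf xs).
Qed.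

Lemma ideal_gen_sqf (k : fieldType) (S : {mpoly k[n]} -> Prop)
    (FF : {set {set 'I_n}}) f :
  (forall q, S q <-> exists2 A, A \in FF & q = 'X_[mono A]) ->
  ideal_gen S f <-> sqf_ideal FF f.
Proof.
move=> S_FF; split=> [[s sS ->]|hf].
  apply: sqf_ideal_sum => q /sS/S_FF[A AFF ->] _.

  by apply/sqf_ideal_mul/(sqf_idealX AFF); rewrite mvars_mono.
(* A chosen generator dividing [m]; the default is not reached on the support of [f]. *)
pose gen m := odflt set0 [pick A in FF | A \subset mvars m].
have genP m : m \in msupp f -> gen m \in FF /\ gen m \subset mvars m.
  case/hf => A AFF Am; rewrite /gen; case: pickP => [B /andP[]//|/(_ A)].
  by rewrite AFF Am.
exists [seq (f@_m *: 'X_[m - mono (gen m)], 'X_[mono (gen m)]) | m <- msupp f].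
  by move=> q /mapP[m /genP[genFF _] ->]; apply/S_FF; exists (gen m).
rewrite big_map [LHS]mpolyE; apply: eq_big_seq => m /genP[_ gen_m] /=.
by rewrite -scalerAl -mpolyXD submK // mono_le.
Qed.

End PathIdeals.

(** * Directed paths of a rooted tree as convex chains *)

Section RootPaths.

Variables (T : finType) (e : rel T) (r : T).
Hypothesis e_tree : is_tree e.

(** [is_tree] covers distinct end points; at [v = r] the only simple path is the empty one, as [r]
    would otherwise occur twice. *)
Lemma root_path_exists :
  exists P : T -> seq T, forall v p, simple_path e r v p <-> p = P v.
Proof.
apply: (@fin_all_exists T (fun=> seq T)
  (fun v q => forall p, simple_path e r v p <-> p = q)) => v.
have [<-{v}|ne_rv] := eqVneq r v.
  exists [::] => p; split=> [/and3P[_ /eqP last_p]|-> //].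
    by case: p last_p => //= x p <-; rewrite mem_last.
  by rewrite /simple_path /= eqxx.
have [_ _ /(_ r v ne_rv)[q [simp_q uniq_q]]] := e_tree.
by exists q => p; split=> [/uniq_q|->].
Qed.

Variable P : T -> seq T.
Hypothesis PE : forall v p, simple_path e r v p <-> p = P v.

Lemma last_root_path v : last r (P v) = v.
Proof. by have /and3P[_ /eqP] := (PE v (P v)).2 erefl. Qed.

(** Deleting the last vertex of a simple path from the root leaves a simple path to [u], which is
    [P u] by uniqueness. *)
Lemma dedgeE u v : dedge e r u v <-> P v = rcons (P u) v.
Proof.
split=> [[p simp_p last_p]|P_v]; last first.
  by exists (P u); rewrite ?last_root_path //; apply/PE.
have /PE <- := simp_p; congr rcons; apply/PE.
move: simp_p; rewrite /simple_path rcons_path -rcons_cons rcons_uniq.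
by case/and3P => /andP[-> _] _ /andP[_ ->]; rewrite last_p eqxx.
Qed.

Definition dchain (s : seq T) := forall i, (i.+1 < size s)%N ->
  P (nth r s i.+1) = rcons (P (nth r s i)) (nth r s i.+1).

Lemma dpathE t (p : t.-tuple T) : dpath e r p <-> dchain p.
Proof.
split=> [dp i lt_i|dp i j e_j].
  rewrite size_tuple in lt_i.
  have /dedgeE := dp (Ordinal (ltnW lt_i)) (Ordinal lt_i) erefl.
  by rewrite !(tnth_nth r).
apply/dedgeE; rewrite !(tnth_nth r) e_j; apply: dp.
by rewrite size_tuple -e_j.
Qed.

Lemma dchain_prefix s i d : dchain s -> (i + d < size s)%N ->
  size (P (nth r s (i + d))) = (size (P (nth r s i)) + d)%N
  /\ prefix (P (nth r s i)) (P (nth r s (i + d))).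
Proof.
move=> dc; elim: d => [|d IHd]; first by rewrite !addn0 prefix_refl.
rewrite !addnS => lt_d; have [size_d pre_d] := IHd (ltnW lt_d).
rewrite dc // size_rcons size_d; split=> //.
exact: prefix_trans pre_d (prefix_rcons _ _).
Qed.

(** The depth [size (P v)] grows by one at each step, so a vertex determines its position. This
    makes the generators squarefree. *)
Lemma dchain_uniq s : dchain s -> uniq s.
Proof.
move=> dc; apply/(uniqP r) => i j lt_i lt_j e_ij.
have [size_i _] := dchain_prefix (i := 0) dc lt_i.
have [size_j _] := dchain_prefix (i := 0) dc lt_j.
by apply/(@addnI (size (P (nth r s 0)))); rewrite -size_i -size_j !add0n e_ij.
Qed.

Definition below u v := prefix (P u) (P v).

Lemma below_total u v w : below u w -> below v w -> below u v || below v u.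
Proof.
rewrite /below !prefixE => /eqP e_u /eqP e_v.
have [le_uv|/ltnW le_vu] := leqP (size (P u)) (size (P v)).
  by rewrite -[X in take _ X]e_v take_takel // e_u eqxx.
by rewrite -[X in _ || (take _ X == _)]e_u take_takel // e_v eqxx orbT.
Qed.

Lemma below_size u v : below u v -> (size (P u) <= size (P v))%N.
Proof. by move/size_prefix. Qed.

Lemma below_eq u v : below u v -> size (P u) = size (P v) -> u = v.
Proof.
rewrite /below prefixE => /eqP e_u e_size.
by rewrite -(last_root_path u) -e_u e_size take_size last_root_path.
Qed.

Lemma below_height u v : below u v -> u = v \/ (size (P u) < size (P v))%N.
Proof.
move=> uv; have := below_size uv; rewrite leq_eqVlt.
case/orP=> [/eqP|]; last by right.
by left; apply: below_eq.
Qed.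

(** A vertex [b] between two vertices of the path has the depth of some vertex of the path. Both lie
    below [c], so they are comparable, and equal depth makes them equal. *)
Lemma dchain_convex (s : seq T) : dchain s ->
  convex_chain below [set: T] [set x in s].
Proof.
move=> dc; split; first exact: subsetT.
  move=> a b; rewrite !inE => /(nthP r)[i lt_i <-] /(nthP r)[j lt_j <-].
  have [le_ij|/ltnW le_ji] := leqP i j.
    have := dchain_prefix (i := i) (d := j - i) dc.
    by rewrite subnKC // => /(_ lt_j)[_]; rewrite /below => ->.
  have := dchain_prefix (i := j) (d := i - j) dc.
  by rewrite subnKC // => /(_ lt_i)[_]; rewrite /below => ->; rewrite orbT.
move=> a b c; rewrite !inE => /(nthP r)[i lt_i <-] /(nthP r)[j lt_j <-] _ ab bc.
have sizeP l := dchain_prefix (i := 0) (d := l) dc.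
have [size_i _] := sizeP i lt_i; have [size_j _] := sizeP j lt_j.
have := below_size bc; have := below_size ab.
rewrite !add0n in size_i size_j; rewrite size_i size_j.
set m := size (P (nth r s 0)) => le_ib le_bj.
pose l := (size (P b) - m)%N.
have e_b : size (P b) = (m + l)%N.
  by rewrite subnKC // (leq_trans (leq_addr i m)).
have le_lj : (l <= j)%N by rewrite -(leq_add2l m) -e_b.
have lt_l := leq_ltn_trans le_lj lt_j.
suff -> : b = nth r s l by apply: mem_nth.
have [size_l _] := sizeP l lt_l; rewrite add0n -/m -e_b in size_l.
have := dchain_prefix (i := l) (d := j - l) dc.
rewrite subnKC // => /(_ lt_j)[_ lj].
have /orP[bl|lb] := below_total bc lj; first exact: below_eq.
by apply/esym/below_eq.
Qed.

End RootPaths.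

Lemma resolvable_path_ideal n (e : rel 'I_n) (r : 'I_n) (t : nat) :
  is_tree e -> resolvable (fun k => path_ideal k e r t).
Proof.
move=> e_tree; have [P PE] := root_path_exists r e_tree.
(* A Boolean form of [dpath], so that the vertex sets of paths form a finite set. *)
pose dchainb (p : t.-tuple 'I_n) :=
  [forall i : 'I_t, forall j : 'I_t, (j == i.+1 :> nat) ==>
     (P (tnth p j) == rcons (P (tnth p i)) (tnth p j))].
have dchainP p : dpath e r p <-> dchainb p.
  split=> [dp|/forallP dp i j e_j].
    apply/forallP => i; apply/forallP => j; apply/implyP => /eqP e_j.
    exact/eqP/(dedgeE PE)/dp.
  by apply/(dedgeE PE)/eqP; move/forallP: (dp i) => /(_ j); rewrite e_j eqxx.
pose FF := [set [set x in tval p] | p in dchainb].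
apply: (@resolvable_ext _ _ (sqf_ideal FF)) => [k f|].
  apply: ideal_gen_sqf => q; split=> [[p dp ->]|[_ /imsetP[p dp ->] ->]].
    exists [set x in tval p]; first by apply: imset_f; apply/dchainP.
    by apply/mono_seq/(dchain_uniq (P := P) (r := r))/(dpathE PE).
  exists p; first exact/dchainP.
  apply/esym/mono_seq/(dchain_uniq (P := P) (r := r))/(dpathE PE)/dchainP.
  exact: dp.
apply: (@resolvable_convex_chains _ (below P) (size \o P) [set: 'I_n]).
- exact: below_total.
- exact: below_height PE.
- move=> _ /imsetP[p /dchainP/(dpathE PE) dp ->].
  exact: dchain_convex dp.
Qed.

Theorem theorem3p1 (n : nat) (e : rel 'I_n) (r : 'I_n) (t : nat)
    (e_tree : is_tree e) (t_ge2 : (2 <= t)%N) :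
  forall (i : nat) (j : int), exists b : nat,
    forall k : fieldType, is_graded_betti (path_ideal k e r t) i j b.
Proof.
move=> i j; have [rks [s res]] := resolvable_path_ideal r t e_tree.
(* The count uses ranks and shifts fixed before [k]; [eq_betti] transfers it to every minimal
   resolution. *)
exists #|[set a : 'I_(rks i) | s i a == j]| => k.
have [bd [aug min_res]] := res k.
by split=> [|F min_F]; [eexists; exact: min_res|exact: eq_betti min_F min_res].
Qed.
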